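(* Let $\alpha: I\to\mathbb{R}^3$ be a space curve parametrized by arc-length $s$, with nowhere vanishing curvature, unit tangent vector $T$ and unit binormal vector $B$. Let $\sigma=\int_0^s\|T'(s)\|\,ds$ be the arc-length parameter of the tangent indicatrix of $\alpha$, and regard $T$ and $B$ as functions of $\sigma$. Let $a,\theta$ be constant real numbers (with $\cot\theta$ defined), let $c\in\mathbb{R}^3$ be a constant vector, and let $\sigma_0$ be a fixed parameter value. Then $$\tilde\gamma_T(\sigma)=a\int_{\sigma_0}^{\sigma}T(\sigma)\,d\sigma+a\cot\theta\int_{\sigma_0}^{\sigma}B(\sigma)\,d\sigma+c$$ is a Bertrand curve.
   Context: For a unit speed curve $\alpha$ in $\mathbb{R}^3$: $T=\alpha'$, the curvature is $\kappa=\|\alpha''\|$, and where $\kappa\neq0$ the unit principal normal $N$ is defined by $\alpha''=\kappa N$ and the unit binormal is $B=T\times N$. The torsion $\tau$ is defined by the Frenet-Serret formulae $T'=\kappa N$, $N'=-\kappa T+\tau B$, $B'=-\tau N$. The tangent indicatrix $(T)$ is the curve on the unit sphere $\mathbb{S}^2$ traced by $T(s)$. Convention: curves are regular and, wherever the Frenet frame is used, have nowhere vanishing curvature; this applies also to the curve $\tilde\gamma_T$ (i.e. $a,\theta$ are such that it is a regular curve with nonvanishing curvature). A Bertrand curve is a curve in $\mathbb{R}^3$ which shares its principal normals with another curve (its Bertrand mate). The characterization used in the paper: a curve with curvature $\kappa$ and torsion $\tau$ is a Bertrand curve if and only if there exist non-zero real numbers $A,B$ such that $A\kappa+B\tau=1$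 at every parameter value.
   Formalization: The relation Aκ+Bτ=1 with nonzero A, B is claimed only for cot θ≠0 (it fails in general at cot θ=0); for every θ the curve is shown to share its principal normals with a mate that may have singular or zero-curvature points, since an everywhere regular mate need not exist. *)

(* Defs.v *)
From Stdlib Require Import Reals.
From Coquelicot Require Import Coquelicot.
Open Scope R_scope.

Notation R3 := (R * R * R)%type.

Definition vx (u : R3) : R := fst (fst u).
Definition vy (u : R3) : R := snd (fst u).
Definition vz (u : R3) : R := snd u.

Definition dot (u v : R3) : R := vx u * vx v + vy u * vy v + vz u * vz v.

Definition vnorm (u : R3) : R := sqrt (dot u u).

Definition cross (u v : R3) : R3 :=
  (vy u * vz v - vz u * vy v,
   vz u * vx v - vx u * vz v,
   vx u * vy v - vy u * vx v).

(* Coquelicot's [Derive] is scalar and its [RInt] needs a complete normed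
   module, a structure not declared for products; both are taken
   coordinatewise. *)
Definition vDerive (c : R -> R3) (t : R) : R3 :=
  (Derive (fun u => vx (c u)) t,
   Derive (fun u => vy (c u)) t,
   Derive (fun u => vz (c u)) t).

Definition vRInt (c : R -> R3) (a b : R) : R3 :=
  (RInt (fun u => vx (c u)) a b,
   RInt (fun u => vy (c u)) a b,
   RInt (fun u => vz (c u)) a b).

Definition real_C3_on (D : R -> Prop) (f : R -> R) : Prop :=
  forall t, D t ->
    (forall n, (n <= 3)%nat -> ex_derive_n f n t) /\
    continuous (Derive_n f 3) t.

Definition C3_on (D : R -> Prop) (c : R -> R3) : Prop :=
  real_C3_on D (fun t => vx (c t)) /\
  real_C3_on D (fun t => vy (c t)) /\
  real_C3_on D (fun t => vz (c t)).

(* Derivative of a field [X] along [c] with respect to the arc length of [c].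
   The Frenet apparatus below is thus defined for any regular parameter; when
   [c] has unit speed, [Ds c] is the ordinary derivative, so that [tangent] is
   c', [curvature] is ||c''|| and [normal] is c''/||c''||. *)
Definition Ds (c X : R -> R3) (t : R) : R3 :=
  scal (/ vnorm (vDerive c t)) (vDerive X t).

Definition tangent (c : R -> R3) : R -> R3 := Ds c c.

Definition curvature (c : R -> R3) (t : R) : R := vnorm (Ds c (tangent c) t).

Definition normal (c : R -> R3) (t : R) : R3 :=
  scal (/ curvature c t) (Ds c (tangent c) t).

Definition binormal (c : R -> R3) (t : R) : R3 :=
  cross (tangent c t) (normal c t).

(* The coefficient of the binormal in N' = - kappa T + tau B. *)
Definition torsion (c : R -> R3) (t : R) : R :=
  dot (Ds c (normal c) t) (binormal c t).

(* A regular curve with nowhere vanishing curvature on [D], whose Frenet frame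
   is differentiable there. *)
Definition frenet_curve (D : R -> Prop) (c : R -> R3) : Prop :=
  forall t, D t ->
    ex_derive c t /\ vDerive c t <> zero /\
    ex_derive (tangent c) t /\ curvature c t <> 0 /\
    ex_derive (normal c) t.

(* [c] and [d] share their principal normals: [d t] lies on the principal
   normal line of [c] at [t], and the direction [normal c t] of that line is
   the principal normal direction of [d] at [t].  A Bertrand mate may have
   singular points or points of zero curvature even if [c] has none, so the
   last condition is expressed through a differentiable unit tangent field [U]
   of [d] : d' is parallel to U, and U' is parallel to [normal c t], which is
   orthogonal to U.  Wherever [d] is regular with non-zero curvature this says
   exactly that the principal normal of [d] is [normal c t] up to sign. *)
Definition bertrand_mate (D : R -> Prop) (c d : R -> R3) : Prop :=
  (exists t, D t /\ d t <> c t) /\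
  (exists t, D t /\ vDerive d t <> zero) /\
  (forall t, D t -> exists r : R, d t = plus (c t) (scal r (normal c t))) /\
  (exists U : R -> R3, forall t, D t ->
     vnorm (U t) = 1 /\
     dot (U t) (normal c t) = 0 /\
     (exists v : R, is_derive d t (scal v (U t))) /\
     (exists w : R, is_derive U t (scal w (normal c t)))).

Definition bertrand_curve (D : R -> Prop) (c : R -> R3) : Prop :=
  frenet_curve D c /\ exists d : R -> R3, bertrand_mate D c d.

Definition bertrand_relation (D : R -> Prop) (c : R -> R3) : Prop :=
  exists A B : R, A <> 0 /\ B <> 0 /\
    forall t, D t -> A * curvature c t + B * torsion c t = 1.

Definition Rbar_interval (lo hi : Rbar) (t : R) : Prop :=
  Rbar_lt lo t /\ Rbar_lt t hi.

Definition indicatrix_arclength (alpha : R -> R3) (s : R) : R :=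
  RInt (fun u => vnorm (vDerive (tangent alpha) u)) 0 s.

Definition image (I : R -> Prop) (f : R -> R) (y : R) : Prop :=
  exists s, I s /\ y = f s.

(* [S] gives the arc length of [alpha] as a function of that of its tangent
   indicatrix. *)
Definition gamma_T (alpha : R -> R3) (S : R -> R) (a theta sigma0 : R) (c : R3)
    (sigma : R) : R3 :=
  plus
    (plus
       (scal a (vRInt (fun y => tangent alpha (S y)) sigma0 sigma))
       (scal (a * (cos theta / sin theta))
             (vRInt (fun y => binormal alpha (S y)) sigma0 sigma)))
    c.

(* Main.v *)
(** Let [sigma] be the arc length of the tangent indicatrix, so that
    [d/dsigma = (1/kappa) d/ds]; with [f = tau/kappa] the Frenet-Serret formulae
    become [T' = N], [N' = - T + f B], [B' = - f N].  With [m = cot theta] one has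
    [gamma' = a (T + m B)], of constant length [p] with [p^2 = a^2 (1 + m^2)].
    Hence [gamma] has normal [eta N], curvature [eta (a/p^2) (1 - m f)] and
    torsion [(a/p^2) (m + f)], where [eta = +1 or -1] is constant because
    [1 - m f] is continuous and never zero on an interval.  Therefore
    [eta a * curvature + a m * torsion = 1].  The curve [gamma + a N] has velocity
    [a (m + f) B], so it is a mate with tangent field [B] unless it is constant. *)

Require Import Defs.
From Stdlib Require Import Reals Ranalysis5 Lra Classical.
From Coquelicot Require Import Coquelicot.
Open Scope R_scope.

(** * Vector algebra in three-dimensional space *)

Lemma R3_ext (u v : R3) : vx u = vx v -> vy u = vy v -> vz u = vz v -> u = v.
Proof.
  destruct u as [[u1 u2] u3], v as [[v1 v2] v3]; unfold vx, vy, vz; simpl.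
  now intros -> -> ->.
Qed.

(* Conversion rather than rewriting: the operations on [R3] occur through
   several convertible canonical structures. *)
Ltac vcoord :=
  cbv beta; unfold dot;
  repeat match goal with
  | |- context [vx ?e] =>
    match e with
    | @zero _ => change (vx e) with 0
    | @plus _ ?u ?v => change (vx e) with (vx u + vx v)
    | @scal _ _ ?k ?u => change (vx e) with (k * vx u)
    | cross ?u ?v => change (vx e) with (vy u * vz v - vz u * vy v)
    end
  | |- context [vy ?e] =>
    match e with
    | @zero _ => change (vy e) with 0
    | @plus _ ?u ?v => change (vy e) with (vy u + vy v)
    | @scal _ _ ?k ?u => change (vy e) with (k * vy u)
    | cross ?u ?v => change (vy e) with (vz u * vx v - vx u * vz v)
    end
  | |- context [vz ?e] =>
    match e with
    | @zero _ => change (vz e) with 0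
    | @plus _ ?u ?v => change (vz e) with (vz u + vz v)
    | @scal _ _ ?k ?u => change (vz e) with (k * vz u)
    | cross ?u ?v => change (vz e) with (vx u * vy v - vy u * vx v)
    end
  end.
Ltac vring := intros; vcoord; ring.
Ltac vext := intros; apply R3_ext; vring.

Lemma dot_comm u v : dot u v = dot v u.
Proof. vring. Qed.
Lemma dot_plus_l u v w : dot (plus u v) w = dot u w + dot v w.
Proof. vring. Qed.
Lemma dot_plus_r u v w : dot u (plus v w) = dot u v + dot u w.
Proof. vring. Qed.
Lemma dot_scal_l (k : R) u v : dot (scal k u) v = k * dot u v.
Proof. vring. Qed.
Lemma dot_scal_r (k : R) u v : dot u (scal k v) = k * dot u v.
Proof. vring. Qed.
Lemma dot_cross_l u v : dot u (cross u v) = 0.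
Proof. vring. Qed.
Lemma dot_cross_r u v : dot v (cross u v) = 0.
Proof. vring. Qed.
(** Lagrange's identity; it gives the length of a cross product of orthonormal vectors and forces a
    vector to vanish when it is both parallel and orthogonal to a unit vector. *)
Lemma dot_cross_cross u v :
  dot (cross u v) (cross u v) = dot u u * dot v v - dot u v * dot u v.
Proof. vring. Qed.
Lemma cross_cross_l u v w :
  cross (cross u v) w = plus (scal (dot u w) v) (scal (- dot v w) u).
Proof. vext. Qed.
Lemma cross_cross_r u v w :
  cross u (cross v w) = plus (scal (dot u w) v) (scal (- dot u v) w).
Proof. vext. Qed.
Lemma cross_plus_l u v w : cross (plus u v) w = plus (cross u w) (cross v w).
Proof. vext. Qed.
Lemma cross_plus_r u v w : cross u (plus v w) = plus (cross u v) (cross u w).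
Proof. vext. Qed.
Lemma cross_scal_l (k : R) u v : cross (scal k u) v = scal k (cross u v).
Proof. vext. Qed.
Lemma cross_scal_r (k : R) u v : cross u (scal k v) = scal k (cross u v).
Proof. vext. Qed.
Lemma cross_diag u : cross u u = zero.
Proof. vext. Qed.

Lemma dot_ge_0 u : 0 <= dot u u.
Proof. unfold dot; nra. Qed.

Lemma dot_eq_0 u : dot u u = 0 -> u = zero.
Proof. unfold dot; intros H; apply R3_ext; vcoord; nra. Qed.

Lemma vnorm_scal (k : R) u : vnorm (scal k u) = Rabs k * vnorm u.
Proof.
  unfold vnorm; rewrite dot_scal_l, dot_scal_r, <- sqrt_Rsqr_abs.
  rewrite <- sqrt_mult_alt by apply Rle_0_sqr; f_equal; unfold Rsqr; ring.
Qed.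

Lemma vnorm_sqr u : vnorm u * vnorm u = dot u u.
Proof. apply sqrt_sqrt, dot_ge_0. Qed.

Lemma dot_self_1 u : vnorm u = 1 -> dot u u = 1.
Proof. intros H; rewrite <- vnorm_sqr, H; ring. Qed.

Lemma vnorm_1 u : dot u u = 1 -> vnorm u = 1.
Proof. unfold vnorm; intros ->; apply sqrt_1. Qed.

(* The part of [v] orthogonal to [t], [n] and [t x n] vanishes: being
   orthogonal to [t] and [n] it is parallel to [t x n]. *)
Lemma orthonormal_decomposition (t n v : R3) :
  dot t t = 1 -> dot n n = 1 -> dot t n = 0 ->
  v = plus (plus (scal (dot v t) t) (scal (dot v n) n))
        (scal (dot v (cross t n)) (cross t n)).
Proof.
  intros Ht Hn Htn.
  set (b := cross t n).
  set (p := plus (plus (scal (dot v t) t) (scal (dot v n) n))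
              (scal (dot v b) b)).
  assert (Hb : dot b b = 1) by (unfold b; rewrite dot_cross_cross; nra).
  assert (Htb : dot t b = 0) by apply dot_cross_l.
  assert (Hnb : dot n b = 0) by apply dot_cross_r.
  set (w := plus v (scal (-1) p)).
  assert (Hnt : dot n t = 0) by (rewrite dot_comm; exact Htn).
  assert (Hbt : dot b t = 0) by (rewrite dot_comm; exact Htb).
  assert (Hbn : dot b n = 0) by (rewrite dot_comm; exact Hnb).
  assert (Hwt : dot w t = 0).
  { unfold w, p; rewrite ?dot_plus_l, ?dot_scal_l, ?dot_plus_l, ?dot_scal_l.
    rewrite Ht, Hnt, Hbt; ring. }
  assert (Hwn : dot w n = 0).
  { unfold w, p; rewrite ?dot_plus_l, ?dot_scal_l, ?dot_plus_l, ?dot_scal_l.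
    rewrite Hn, Htn, Hbn; ring. }
  assert (Hwb : dot w b = 0).
  { unfold w, p; rewrite ?dot_plus_l, ?dot_scal_l, ?dot_plus_l, ?dot_scal_l.
    rewrite Hb, Htb, Hnb; ring. }
  assert (Hw : w = zero).
  { apply dot_eq_0.
    assert (H : cross w b = zero).
    { unfold b; rewrite cross_cross_r, Hwt, Hwn; vext. }
    pose proof (dot_cross_cross w b) as H'.
    rewrite H, Hb, Hwb in H'.
    replace (dot zero zero) with 0 in H' by vring; lra. }
  replace v with (plus w p) by (unfold w; vext).
  rewrite Hw; vext.
Qed.

(** * Derivatives and continuity of vector functions, reduced to coordinates *)

Lemma is_derive_pair {U V : NormedModule R_AbsRing} (f : R -> U) (g : R -> V)
    (t : R) (l : U) (m : V) :
  is_derive f t l -> is_derive g t m ->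
  is_derive (fun s => (f s, g s) : prod_NormedModule R_AbsRing U V) t (l, m).
Proof.
  intros Hf Hg.
  apply (filterdiff_comp'_2 f g (fun u v => (u, v)) t _ _ (fun u v => (u, v)) Hf Hg).
  (* Pairing the two components is the identity of the product space, hence its own differential. *)
  apply filterdiff_ext_lin with (fun u => u); [|now intros [u v]].
  apply filterdiff_ext with (fun u => u); [now intros [u v]|].
  apply filterdiff_id.
Qed.

Lemma is_derive_fst {U V : NormedModule R_AbsRing} (f : R -> U * V)
    (t : R) (l : U * V) :
  is_derive f t l -> is_derive (fun s => fst (f s)) t (fst l).
Proof.
  intros Hf.
  apply (filterdiff_comp' f fst t _ fst Hf), filterdiff_linear, is_linear_fst.
Qed.

Lemma is_derive_snd {U V : NormedModule R_AbsRing} (f : R -> U * V)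
    (t : R) (l : U * V) :
  is_derive f t l -> is_derive (fun s => snd (f s)) t (snd l).
Proof.
  intros Hf.
  apply (filterdiff_comp' f snd t _ snd Hf), filterdiff_linear, is_linear_snd.
Qed.

Lemma is_derive_coord (X : R -> R3) (t : R) (l : R3) :
  is_derive X t l <->
  is_derive (fun s => vx (X s)) t (vx l) /\
  is_derive (fun s => vy (X s)) t (vy l) /\
  is_derive (fun s => vz (X s)) t (vz l).
Proof.
  split.
  - intros H; split; [|split].
    + exact (is_derive_fst _ _ _ (is_derive_fst _ _ _ H)).
    + exact (is_derive_snd _ _ _ (is_derive_fst _ _ _ H)).
    + exact (is_derive_snd _ _ _ H).
  - intros [Hx [Hy Hz]].
    apply is_derive_ext with (fun s => (vx (X s), vy (X s), vz (X s))).
    + now intros s; apply R3_ext.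
    + replace l with ((vx l, vy l, vz l) : R3) by now apply R3_ext.
      exact (is_derive_pair _ _ _ _ _ (is_derive_pair _ _ _ _ _ Hx Hy) Hz).
Qed.

Lemma continuous_fst_comp {U V : UniformSpace} (f : R -> U * V) (t : R) :
  continuous f t -> continuous (fun s => fst (f s)) t.
Proof.
  intros H; apply (continuous_comp f fst t H).
  rewrite (surjective_pairing (f t)); apply continuous_fst.
Qed.

Lemma continuous_snd_comp {U V : UniformSpace} (f : R -> U * V) (t : R) :
  continuous f t -> continuous (fun s => snd (f s)) t.
Proof.
  intros H; apply (continuous_comp f snd t H).
  rewrite (surjective_pairing (f t)); apply continuous_snd.
Qed.

Lemma continuous_coord (X : R -> R3) (t : R) :
  continuous X t <->
  continuous (fun s => vx (X s)) t /\
  continuous (fun s => vy (X s)) t /\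
  continuous (fun s => vz (X s)) t.
Proof.
  split.
  - intros H; split; [|split].
    + apply continuous_fst_comp with (f := fun s => fst (X s)).
      apply continuous_fst_comp, H.
    + apply continuous_snd_comp with (f := fun s => fst (X s)).
      apply continuous_fst_comp, H.
    + apply continuous_snd_comp, H.
  - intros [Hx [Hy Hz]].
    apply continuous_ext with (fun s => (vx (X s), vy (X s), vz (X s))).
    + now intros s; apply R3_ext.
    + apply (continuous_comp_2 (fun s => (vx (X s), vy (X s)))
               (fun s => vz (X s)) (fun u v => (u, v))).
      * apply (continuous_comp_2 (fun s => vx (X s))
                 (fun s => vy (X s)) (fun u v => (u, v))); try assumption.
        apply continuous_ext with (fun u => u); [now intros [u v]|].
        apply continuous_id.
      * exact Hz.
      * apply continuous_ext with (fun u => u); [now intros [u v]|].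
        apply continuous_id.
Qed.

Lemma is_derive_eq {V : NormedModule R_AbsRing} (f : R -> V) (t : R) (l l' : V) :
  is_derive f t l -> l = l' -> is_derive f t l'.
Proof. now intros H <-. Qed.

(** The real case is kept apart so that the residual equation is typed in [R] and not in the carrier
    of a normed module. *)
Lemma is_derive_Req (f : R -> R) (t l l' : R) :
  is_derive f t l -> l = l' -> is_derive f t l'.
Proof. now intros H <-. Qed.

Lemma is_derive_vDerive (X : R -> R3) (t : R) (l : R3) :
  is_derive X t l -> vDerive X t = l.
Proof.
  intros H; apply is_derive_coord in H; destruct H as [Hx [Hy Hz]].
  apply R3_ext; apply is_derive_unique; assumption.
Qed.

Lemma is_derive_Rmult (f g : R -> R) (t l m : R) :
  is_derive f t l -> is_derive g t m ->
  is_derive (fun s => f s * g s) t (l * g t + f t * m).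
Proof.
  intros Hf Hg; exact (is_derive_mult f g t l m Hf Hg Rmult_comm).
Qed.

Lemma is_derive_Rplus (f g : R -> R) (t l m : R) :
  is_derive f t l -> is_derive g t m ->
  is_derive (fun s => f s + g s) t (l + m).
Proof. exact (is_derive_plus f g t l m). Qed.

Lemma is_derive_Rminus (f g : R -> R) (t l m : R) :
  is_derive f t l -> is_derive g t m ->
  is_derive (fun s => f s - g s) t (l - m).
Proof. exact (is_derive_minus f g t l m). Qed.

Lemma is_derive_dot (X Y : R -> R3) (t : R) (l m : R3) :
  is_derive X t l -> is_derive Y t m ->
  is_derive (fun s => dot (X s) (Y s)) t (dot l (Y t) + dot (X t) m).
Proof.
  intros HX HY; apply is_derive_coord in HX, HY.
  destruct HX as [X1 [X2 X3]], HY as [Y1 [Y2 Y3]].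
  eapply is_derive_Req.
  - apply is_derive_Rplus; [apply is_derive_Rplus|]; apply is_derive_Rmult;
      eassumption.
  - vring.
Qed.

Lemma is_derive_vscal (k : R -> R) (X : R -> R3) (t k' : R) (l : R3) :
  is_derive k t k' -> is_derive X t l ->
  is_derive (fun s => scal (k s) (X s)) t (plus (scal k' (X t)) (scal (k t) l)).
Proof.
  intros Hk HX; apply is_derive_coord in HX; apply is_derive_coord.
  destruct HX as [X1 [X2 X3]].
  split; [|split]; (eapply is_derive_Req;
    [apply is_derive_Rmult; eassumption | reflexivity]).
Qed.

Lemma is_derive_vscal_const (k : R) (X : R -> R3) (t : R) (l : R3) :
  is_derive X t l -> is_derive (fun s => scal k (X s)) t (scal k l).
Proof.
  intros HX.
  apply is_derive_eq with (plus (scal 0 (X t)) (scal k l)); [|vext].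
  exact (is_derive_vscal (fun _ => k) X t 0 l (is_derive_const k t) HX).
Qed.

Lemma is_derive_cross (X Y : R -> R3) (t : R) (l m : R3) :
  is_derive X t l -> is_derive Y t m ->
  is_derive (fun s => cross (X s) (Y s)) t (plus (cross l (Y t)) (cross (X t) m)).
Proof.
  intros HX HY; apply is_derive_coord in HX, HY; apply is_derive_coord.
  destruct HX as [X1 [X2 X3]], HY as [Y1 [Y2 Y3]].
  split; [|split].
  - eapply is_derive_Req;
      [exact (is_derive_Rminus _ _ t _ _ (is_derive_Rmult _ _ t _ _ X2 Y3)
                (is_derive_Rmult _ _ t _ _ X3 Y2)) | vring].
  - eapply is_derive_Req;
      [exact (is_derive_Rminus _ _ t _ _ (is_derive_Rmult _ _ t _ _ X3 Y1)
                (is_derive_Rmult _ _ t _ _ X1 Y3)) | vring].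
  - eapply is_derive_Req;
      [exact (is_derive_Rminus _ _ t _ _ (is_derive_Rmult _ _ t _ _ X1 Y2)
                (is_derive_Rmult _ _ t _ _ X2 Y1)) | vring].
Qed.

Lemma continuous_dot (X Y : R -> R3) (t : R) :
  continuous X t -> continuous Y t -> continuous (fun s => dot (X s) (Y s)) t.
Proof.
  intros HX HY; apply continuous_coord in HX, HY.
  destruct HX as [X1 [X2 X3]], HY as [Y1 [Y2 Y3]].
  unfold dot.
  apply (continuous_plus (V := R_NormedModule));
    [apply (continuous_plus (V := R_NormedModule))|];
    apply (continuous_mult (K := R_AbsRing)); assumption.
Qed.

Lemma is_derive_continuous (f : R -> R) (t l : R) :
  is_derive f t l -> continuous f t.
Proof. intros H; apply (ex_derive_continuous f t); now exists l. Qed.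

Lemma is_derive_vcontinuous (X : R -> R3) (t : R) (l : R3) :
  is_derive X t l -> continuous X t.
Proof. intros H; apply (ex_derive_continuous X t); now exists l. Qed.

Lemma scal_neq_0 (k : R) (u : R3) : k <> 0 -> u <> zero -> scal k u <> zero.
Proof.
  intros Hk Hu H; apply Hu.
  replace u with (scal (/ k) (scal k u)).
  - rewrite H; vext.
  - apply R3_ext; vcoord; field; exact Hk.
Qed.

Lemma unit_neq_0 (u : R3) : dot u u = 1 -> u <> zero.
Proof.
  intros H ->; replace (dot zero zero) with 0 in H by vring; lra.
Qed.

Lemma Ds_eq (c X : R -> R3) (p t : R) (v l : R3) :
  vDerive c t = v -> vnorm v = p -> is_derive X t l ->
  Ds c X t = scal (/ p) l.
Proof.
  unfold Ds; intros -> -> H; now rewrite (is_derive_vDerive _ _ _ H).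
Qed.

(** Two values of opposite sign would, by the intermediate value theorem, enclose a zero, and order
    convexity would place it in [J]. The sign is then decided classically by whether a positive
    value occurs. *)
Lemma constant_sign (J : R -> Prop) (h : R -> R) :
  (forall x y z, J x -> J z -> x <= y <= z -> J y) ->
  (forall y, J y -> continuous h y) ->
  (forall y, J y -> h y <> 0) ->
  exists eta : R, (eta = 1 \/ eta = -1) /\ forall y, J y -> 0 < eta * h y.
Proof.
  intros Hconv Hc Hn.
  assert (IVT : forall (g : R -> R) x z, x < z ->
    (forall y, x <= y <= z -> continuous g y) ->
    g x < 0 -> 0 < g z -> exists y, x <= y <= z /\ g y = 0).
  { intros g x z Hxz Hg Hx Hz.
    destruct (IVT_interv g x z) as [y Hy]; try assumption.
    - intros y Hy; apply continuity_pt_filterlim, Hg, Hy.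
    - now exists y. }
  assert (Hno : forall x z, J x -> J z -> h x < 0 -> 0 < h z -> False).
  { intros x z Hx Hz hx hz.
    destruct (Rtotal_order x z) as [H | [H | H]].
    - destruct (IVT h x z H) as [y [Hy Hy0]]; try assumption.
      + intros y Hy; apply Hc, (Hconv x y z); assumption.
      + apply (Hn y); [apply (Hconv x y z)|]; assumption.
    - subst z; lra.
    (* The negative value lies to the right of the positive one, so the crossing is found for
       [- h]. *)
    - destruct (IVT (fun y => - h y) z x H) as [y [Hy Hy0]]; try lra.
      + intros y Hy; apply (continuous_opp (V := R_NormedModule)), Hc, (Hconv z y x);
          assumption.
      + apply (Hn y); [apply (Hconv z y x) | lra]; assumption. }
  destruct (classic (exists y, J y /\ 0 < h y)) as [[y [Hy Hpos]] | Hneg].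
  - exists 1; split; [now left|]; intros z Hz.
    destruct (Rtotal_order (h z) 0) as [H | [H | H]]; [| |lra].
    + now destruct (Hno z y Hz Hy H Hpos).
    + now destruct (Hn z Hz).
  - exists (-1); split; [now right|]; intros z Hz.
    destruct (Rtotal_order (h z) 0) as [H | [H | H]]; [lra | |].
    + now destruct (Hn z Hz).
    + destruct Hneg; now exists z.
Qed.

(** * Frenet frames *)

(** The Frenet-Serret system is detached from any curve and has free coefficients. It thus covers
    both [kappa], [tau] in the arc length of [alpha] and [1], [tau / kappa] in the arc length of its
    tangent indicatrix. *)
Definition frenet_frame (D : R -> Prop) (k w : R -> R) (T N B : R -> R3) : Prop :=
  forall t, D t ->
    dot (T t) (T t) = 1 /\ dot (N t) (N t) = 1 /\ dot (T t) (N t) = 0 /\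
    B t = cross (T t) (N t) /\
    is_derive T t (scal (k t) (N t)) /\
    is_derive N t (plus (scal (- k t) (T t)) (scal (w t) (B t))) /\
    is_derive B t (scal (- w t) (N t)).

Section FrameDerivatives.

Context (D : R -> Prop) (k w : R -> R) (T N B : R -> R3)
  (frame : frenet_frame D k w T N B) (t : R) (Ht : D t).

Lemma frame_tangent_derive : is_derive T t (scal (k t) (N t)).
Proof. now destruct (frame t Ht) as [_ [_ [_ [_ [H _]]]]]. Qed.

Lemma frame_normal_derive :
  is_derive N t (plus (scal (- k t) (T t)) (scal (w t) (B t))).
Proof. now destruct (frame t Ht) as [_ [_ [_ [_ [_ [H _]]]]]]. Qed.

Lemma frame_binormal_derive : is_derive B t (scal (- w t) (N t)).
Proof. now destruct (frame t Ht) as [_ [_ [_ [_ [_ [_ H]]]]]]. Qed.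

End FrameDerivatives.

(** * Geometry of a curve with velocity [a (T + m B)] over a frame satisfying [T' = N] *)

Section IndicatrixFrame.

Context (J : R -> Prop) (T N B gamma : R -> R3) (f : R -> R) (a m y0 : R).
Context (J_locally : forall y, J y -> locally y J)
  (J_convex : forall x y z, J x -> J z -> x <= y <= z -> J y)
  (J_y0 : J y0)
  (frame : frenet_frame J (fun _ => 1) f T N B)
  (f_continuous : forall y, J y -> continuous f y)
  (gamma_derive : forall y, J y ->
     is_derive gamma y (scal a (plus (T y) (scal m (B y)))))
  (gamma_regular : forall y, J y -> vDerive gamma y <> zero)
  (gamma_curved : forall y, J y -> curvature gamma y <> 0).

(** [q] is the length of [T + m B], and [p] is the constant speed of [gamma]. *)
Let q := sqrt (1 + m * m).
Let p := Rabs a * q.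

Lemma direction_norm_pos : 0 < q.
Proof. apply sqrt_lt_R0; nra. Qed.

Lemma direction_norm_sqr : q * q = 1 + m * m.
Proof. apply sqrt_sqrt; nra. Qed.

(** For [a = 0] the velocity would vanish at [y0], against regularity. *)
Lemma scale_neq_0 : a <> 0.
Proof.
  intros Ha; apply (gamma_regular y0 J_y0).
  rewrite (is_derive_vDerive _ _ _ (gamma_derive y0 J_y0)), Ha; vext.
Qed.

Lemma speed_pos : 0 < p.
Proof.
  apply Rmult_lt_0_compat;
    [apply Rabs_pos_lt, scale_neq_0 | apply direction_norm_pos].
Qed.

Lemma speed_sqr : p * p = a * a * (1 + m * m).
Proof.
  unfold p; rewrite <- direction_norm_sqr.
  replace (a * a) with (Rabs a * Rabs a); [ring|].
  rewrite <- Rabs_mult, Rabs_pos_eq; nra.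
Qed.

Lemma frame_dots y : J y ->
  dot (B y) (B y) = 1 /\ dot (T y) (B y) = 0 /\ dot (B y) (T y) = 0 /\
  dot (N y) (B y) = 0 /\ dot (B y) (N y) = 0 /\ dot (N y) (T y) = 0.
Proof.
  intros Hy; destruct (frame y Hy) as [HT [HN [HTN [HB _]]]].
  rewrite HB, dot_cross_cross, HT, HN, HTN.
  rewrite (dot_comm (cross _ _) (T y)), (dot_comm (cross _ _) (N y)),
    dot_cross_l, dot_cross_r, (dot_comm (N y)), HTN.
  repeat split; ring.
Qed.

Lemma dot_direction y : J y ->
  dot (plus (T y) (scal m (B y))) (plus (T y) (scal m (B y))) = 1 + m * m.
Proof.
  intros Hy; destruct (frame y Hy) as [HT _].
  destruct (frame_dots y Hy) as [HB [HTB [HBT _]]].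
  rewrite !dot_plus_l, !dot_plus_r, !dot_scal_l, !dot_scal_r, HT, HB, HTB, HBT.
  ring.
Qed.

Lemma vDerive_gamma y : J y ->
  vDerive gamma y = scal a (plus (T y) (scal m (B y))).
Proof. intros Hy; apply is_derive_vDerive, gamma_derive, Hy. Qed.

Lemma gamma_speed y : J y -> vnorm (scal a (plus (T y) (scal m (B y)))) = p.
Proof.
  intros Hy; rewrite vnorm_scal; unfold vnorm; now rewrite dot_direction.
Qed.

Lemma tangent_gamma y : J y ->
  tangent gamma y = scal (a / p) (plus (T y) (scal m (B y))).
Proof.
  intros Hy; unfold tangent.
  rewrite (Ds_eq _ _ _ _ _ _ (vDerive_gamma y Hy) (gamma_speed y Hy)
             (gamma_derive y Hy)).
  pose proof speed_pos; apply R3_ext; vcoord; field; lra.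
Qed.

Lemma direction_derive y : J y ->
  is_derive (fun s => plus (T s) (scal m (B s))) y (scal (1 - m * f y) (N y)).
Proof.
  intros Hy; destruct (frame y Hy) as [_ [_ [_ [_ [HT [_ HB]]]]]].
  eapply is_derive_eq.
  - apply (is_derive_plus _ _ _ _ _ HT (is_derive_vscal_const m _ _ _ HB)).
  - vext.
Qed.

(** The closed form of the tangent is known only on [J]; since [J] is a neighbourhood of each of its
    points, it may be differentiated there. The [T]-free result comes from [T'] and [B'] both being
    multiples of [N]. *)
Lemma tangent_gamma_derive y : J y ->
  is_derive (tangent gamma) y (scal (a / p * (1 - m * f y)) (N y)).
Proof.
  intros Hy.
  apply is_derive_ext_loc with
    (fun s => scal (a / p) (plus (T s) (scal m (B s)))).
  - apply filter_imp with J; [|now apply J_locally].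
    intros s Hs; symmetry; now apply tangent_gamma.
  - eapply is_derive_eq.
    + apply is_derive_vscal_const, direction_derive, Hy.
    + vext.
Qed.

Lemma Ds_tangent_gamma y : J y ->
  Ds gamma (tangent gamma) y = scal (a / (p * p) * (1 - m * f y)) (N y).
Proof.
  intros Hy.
  rewrite (Ds_eq _ _ _ _ _ _ (vDerive_gamma y Hy) (gamma_speed y Hy)
             (tangent_gamma_derive y Hy)).
  pose proof speed_pos; apply R3_ext; vcoord; field; lra.
Qed.

Lemma curvature_gamma_abs y : J y ->
  curvature gamma y = Rabs (a / (p * p) * (1 - m * f y)).
Proof.
  intros Hy; unfold curvature; rewrite (Ds_tangent_gamma y Hy), vnorm_scal.
  destruct (frame y Hy) as [_ [HN _]]; rewrite (vnorm_1 _ HN); ring.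
Qed.

(** The curvature is the absolute value of a continuous function without zeros on an interval. One
    sign [eta] therefore serves for all of [J], which makes [normal gamma] differentiable and lets
    [eta] enter the constants of the Bertrand relation. *)
Lemma gamma_curvature_sign :
  exists eta : R, eta * eta = 1 /\
    (forall y, J y -> curvature gamma y = eta * (a / (p * p) * (1 - m * f y))) /\
    (forall y, J y -> normal gamma y = scal eta (N y)).
Proof.
  destruct (constant_sign J (fun y => a / (p * p) * (1 - m * f y)) J_convex)
    as [eta [Heta Hpos]].
  - intros y Hy; apply (continuous_mult (K := R_AbsRing)); [apply continuous_const|].
    apply (continuous_minus (V := R_NormedModule)); [apply continuous_const|].
    apply (continuous_mult (K := R_AbsRing)); [apply continuous_const|].
    now apply f_continuous.
  - intros y Hy H; apply (gamma_curved y Hy).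
    rewrite (curvature_gamma_abs y Hy), H; apply Rabs_R0.
  - assert (Hcurv : forall y, J y ->
      curvature gamma y = eta * (a / (p * p) * (1 - m * f y))).
    { intros y Hy; rewrite (curvature_gamma_abs y Hy).
      specialize (Hpos y Hy); cbv beta in Hpos.
      set (h := a / (p * p) * (1 - m * f y)) in *.
      destruct Heta as [-> | ->];
        [rewrite Rabs_pos_eq | rewrite Rabs_left]; lra. }
    assert (Heta2 : eta * eta = 1) by (destruct Heta as [-> | ->]; ring).
    exists eta; split; [exact Heta2 | split; [exact Hcurv|]].
    intros y Hy; specialize (Hpos y Hy); cbv beta in Hpos.
    unfold normal; rewrite (Ds_tangent_gamma y Hy), (Hcurv y Hy).
    set (h := a / (p * p) * (1 - m * f y)) in *.
    assert (h <> 0) by (intros E; rewrite E in Hpos; lra).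
    assert (eta <> 0) by (intros E; rewrite E in Hpos; lra).
    replace (scal (/ (eta * h)) (scal h (N y))) with (scal (/ eta) (N y)).
    (* A sign is its own inverse: [/ eta = eta] follows from [eta * eta = 1]. *)
    + f_equal; apply Rmult_eq_reg_l with eta; [|assumption].
      rewrite Heta2; field; assumption.
    + apply R3_ext; vcoord; field; split; assumption.
Qed.

Lemma normal_gamma_derive eta y :
  (forall y, J y -> normal gamma y = scal eta (N y)) -> J y ->
  is_derive (normal gamma) y
    (scal eta (plus (scal (-1) (T y)) (scal (f y) (B y)))).
Proof.
  intros Hn Hy.
  apply is_derive_ext_loc with (fun s => scal eta (N s)).
  - apply filter_imp with J; [|now apply J_locally].
    intros s Hs; symmetry; now apply Hn.
  - apply is_derive_vscal_const, (frame_normal_derive _ _ _ _ _ _ frame y Hy).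
Qed.

(** The sign enters twice, through the derivative of the normal and through the binormal, and so
    cancels. The binormal is [eta (a / p) (B - m T)], whose product with [- T + f B] contributes the
    factor [m + f]. *)
Lemma torsion_gamma eta y :
  eta * eta = 1 -> (forall y, J y -> normal gamma y = scal eta (N y)) -> J y ->
  torsion gamma y = a / (p * p) * (m + f y).
Proof.
  intros Heta Hn Hy; unfold torsion, binormal.
  rewrite (Ds_eq _ _ _ _ _ _ (vDerive_gamma y Hy) (gamma_speed y Hy)
             (normal_gamma_derive eta y Hn Hy)).
  rewrite (tangent_gamma y Hy), (Hn y Hy).
  destruct (frame y Hy) as [HT [HN [HTN [HB _]]]].
  destruct (frame_dots y Hy) as [HBB [HTB [HBT _]]].
  assert (HBN : cross (B y) (N y) = scal (-1) (T y)).
  { rewrite HB, cross_cross_l, HTN, HN; vext. }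
  rewrite cross_scal_l, cross_scal_r, cross_plus_l, cross_scal_l, HBN, <- HB.
  rewrite ?dot_scal_l, ?dot_scal_r, ?dot_plus_l, ?dot_scal_l, ?dot_plus_r,
    ?dot_scal_r, HT, HTB, HBT, HBB.
  pose proof speed_pos.
  transitivity (eta * eta * (a / (p * p) * (m + f y))).
  - field; lra.
  - rewrite Heta; ring.
Qed.

Lemma frenet_gamma : frenet_curve J gamma.
Proof.
  destruct gamma_curvature_sign as [eta [_ [_ Hn]]].
  intros y Hy; split; [|split; [|split; [|split]]].
  - eexists; apply gamma_derive, Hy.
  - now apply gamma_regular.
  - eexists; apply tangent_gamma_derive, Hy.
  - now apply gamma_curved.
  - eexists; apply (normal_gamma_derive eta); assumption.
Qed.

(** With these constants the terms in [f] cancel, leaving [a^2 (1 + m^2) / p^2 = 1]. The assumption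
    on [m] makes the second constant non-zero. *)
Lemma bertrand_relation_gamma : m <> 0 -> bertrand_relation J gamma.
Proof.
  intros Hm; destruct gamma_curvature_sign as [eta [Heta [Hc Hn]]].
  pose proof scale_neq_0 as Ha; pose proof speed_pos as Hp.
  exists (eta * a), (a * m); split; [|split].
  - apply Rmult_integral_contrapositive_currified; [|exact Ha].
    intros E; rewrite E in Heta; lra.
  - now apply Rmult_integral_contrapositive_currified.
  - intros y Hy; rewrite (Hc y Hy), (torsion_gamma eta y Heta Hn Hy).
    transitivity (eta * eta * (a * a * (1 - m * f y) / (p * p))
                  + a * a * (m * m + m * f y) / (p * p)); [field; lra|].
    rewrite Heta, speed_sqr; field; split; [nra | exact Ha].
Qed.

(* The points [gamma + r N] form a mate as soon as their velocity is a multiple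
   [v U] of a unit field [U] orthogonal to [N] with derivative along [N]. *)
Lemma mate_along_normal (r : R) (U : R -> R3) (v w : R -> R) :
  r <> 0 ->
  (forall y, J y -> vnorm (U y) = 1) ->
  (forall y, J y -> dot (U y) (N y) = 0) ->
  (forall y, J y -> is_derive U y (scal (w y) (N y))) ->
  (forall y, J y ->
     plus (scal a (plus (T y) (scal m (B y))))
       (scal r (plus (scal (-1) (T y)) (scal (f y) (B y)))) =
     scal (v y) (U y)) ->
  (exists y, J y /\ v y <> 0) ->
  bertrand_mate J gamma (fun y => plus (gamma y) (scal r (N y))).
Proof.
  intros Hr HU HUN HdU Hv [y1 [Hy1 Hv1]].
  destruct gamma_curvature_sign as [eta [Heta [_ Hn]]].
  assert (Hd : forall y, J y ->
    is_derive (fun y => plus (gamma y) (scal r (N y))) y (scal (v y) (U y))).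
  { intros y Hy; rewrite <- (Hv y Hy).
    apply (is_derive_plus gamma (fun y => scal r (N y))).
    - now apply gamma_derive.
    - apply is_derive_vscal_const, (frame_normal_derive _ _ _ _ _ _ frame y Hy). }
  split; [|split; [|split]].
  - exists y0; split; [exact J_y0|]; intros E.
    destruct (frame y0 J_y0) as [_ [HN _]].
    apply (scal_neq_0 r _ Hr (unit_neq_0 _ HN)).
    replace (scal r (N y0)) with
      (plus (plus (gamma y0) (scal r (N y0))) (scal (-1) (gamma y0))) by vext.
    rewrite E; vext.
  - exists y1; split; [exact Hy1|].
    pose proof (is_derive_vDerive _ _ _ (Hd y1 Hy1)) as E.
    intros E0; apply (scal_neq_0 (v y1) (U y1) Hv1).
    + apply unit_neq_0, dot_self_1, HU, Hy1.
    + exact (eq_trans (eq_sym E) E0).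
  (* The displacement is [r N], while the mate condition measures it along [normal gamma = eta N];
     the factor [eta] compensates because [eta * eta = 1]. *)
  - intros y Hy; exists (r * eta); rewrite (Hn y Hy); f_equal.
    replace (scal (r * eta) (scal eta (N y))) with (scal (eta * eta) (scal r (N y)))
      by vext.
    rewrite Heta; vext.
  - exists U; intros y Hy; split; [now apply HU | split; [|split]].
    + rewrite (Hn y Hy), dot_scal_r, (HUN y Hy); ring.
    + exists (v y); now apply Hd.
    + exists (w y * eta); rewrite (Hn y Hy).
      replace (scal (w y * eta) (scal eta (N y)))
        with (scal (eta * eta) (scal (w y) (N y))) by vext.
      rewrite Heta; eapply is_derive_eq; [now apply HdU | vext].
Qed.

(* When [m + f] vanishes identically [gamma] is an arc of a circle and
   [gamma + a N] is constantly its center; a concentric circle is then a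
   mate. *)
Lemma bertrand_gamma : bertrand_curve J gamma.
Proof.
  split; [exact frenet_gamma|].
  pose proof scale_neq_0 as Ha.
  destruct (classic (exists y, J y /\ m + f y <> 0)) as [[y1 [Hy1 Hf1]] | Hf].
  - eexists; apply (mate_along_normal a B (fun y => a * (m + f y)) (fun y => - f y)).
    + exact Ha.
    + intros y Hy; apply vnorm_1, frame_dots, Hy.
    + intros y Hy; apply frame_dots, Hy.
    + exact (frame_binormal_derive _ _ _ _ _ _ frame).
    + vext.
    + exists y1; split; [exact Hy1|].
      now apply Rmult_integral_contrapositive_currified.
  - assert (Hf' : forall y, J y -> f y = - m).
    { intros y Hy; destruct (Req_dec (m + f y) 0) as [H | H]; [lra|].
      destruct Hf; now exists y. }
    pose proof direction_norm_pos as Hq.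
    (* Here [f = - m], so [gamma + 2 a N] has velocity [- a (T + m B)]: it is the antipodal point of
       the same circle, with unit tangent field [(T + m B) / q]. *)
    eexists; apply (mate_along_normal (2 * a)
      (fun y => scal (/ q) (plus (T y) (scal m (B y)))) (fun _ => - a * q)
      (fun y => / q * (1 - m * f y))).
    + lra.
    + intros y Hy; rewrite vnorm_scal, Rabs_pos_eq
        by (apply Rlt_le, Rinv_0_lt_compat, Hq).
      unfold vnorm; rewrite (dot_direction y Hy); fold q; field; lra.
    + intros y Hy; destruct (frame y Hy) as [_ [_ [HTN _]]].
      destruct (frame_dots y Hy) as [_ [_ [_ [_ [HBN _]]]]].
      rewrite dot_scal_l, dot_plus_l, dot_scal_l, HTN, HBN; ring.
    + intros y Hy; eapply is_derive_eq;
        [apply is_derive_vscal_const, direction_derive, Hy | vext].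
    + intros y Hy; rewrite (Hf' y Hy); apply R3_ext; vcoord; field; lra.
    + exists y0; split; [exact J_y0|].
      apply Rmult_integral_contrapositive_currified; lra.
Qed.

End IndicatrixFrame.

(** * Frenet-Serret formulae for a unit speed curve with successive derivatives [c1], [c2], [c3] *)

(** Applied to the orthonormality relations, this yields the components of the derivatives of the
    frame. *)
Lemma is_derive_dot_constant (X Y : R -> R3) (t c : R) (l m : R3) :
  is_derive X t l -> is_derive Y t m ->
  locally t (fun s => dot (X s) (Y s) = c) ->
  dot l (Y t) + dot (X t) m = 0.
Proof.
  intros HX HY Hc.
  pose proof (is_derive_unique _ _ _ (is_derive_dot _ _ _ _ _ HX HY)) as H.
  rewrite <- H; transitivity (Derive (fun _ => c) t).
  - apply Derive_ext_loc, Hc.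
  - apply Derive_const.
Qed.

Lemma is_derive_vnorm (X : R -> R3) (t : R) (l : R3) :
  is_derive X t l -> vnorm (X t) <> 0 ->
  is_derive (fun s => vnorm (X s)) t
    ((dot l (X t) + dot (X t) l) / (2 * vnorm (X t))).
Proof.
  intros HX Hn.
  apply (is_derive_sqrt (fun s => dot (X s) (X s))).
  - now apply is_derive_dot.
  - pose proof (vnorm_sqr (X t)); nra.
Qed.

Section UnitSpeed.

Context (D : R -> Prop) (c c1 c2 c3 : R -> R3).
Context (D_locally : forall s, D s -> locally s D)
  (c_derive : forall s, D s -> is_derive c s (c1 s))
  (c1_derive : forall s, D s -> is_derive c1 s (c2 s))
  (c2_derive : forall s, D s -> is_derive c2 s (c3 s))
  (c3_continuous : forall s, D s -> continuous c3 s)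
  (unit_speed : forall s, D s -> vnorm (vDerive c s) = 1)
  (curved : forall s, D s -> curvature c s <> 0).

Lemma Ds_unit_speed X s l : D s -> is_derive X s l -> Ds c X s = l.
Proof.
  intros Hs HX; rewrite (Ds_eq _ _ 1 _ _ _ eq_refl (unit_speed s Hs) HX).
  apply R3_ext; vcoord; field.
Qed.

Lemma tangent_unit_speed s : D s -> tangent c s = c1 s.
Proof. intros Hs; apply Ds_unit_speed; [|apply c_derive]; exact Hs. Qed.

Lemma tangent_derive s : D s -> is_derive (tangent c) s (c2 s).
Proof.
  intros Hs; apply is_derive_ext_loc with c1; [|now apply c1_derive].
  apply filter_imp with D; [|now apply D_locally].
  intros t Ht; symmetry; now apply tangent_unit_speed.
Qed.

Lemma Ds_tangent_unit_speed s : D s -> Ds c (tangent c) s = c2 s.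
Proof. intros Hs; apply Ds_unit_speed; [|apply tangent_derive]; exact Hs. Qed.

Lemma curvature_unit_speed s : D s -> curvature c s = vnorm (c2 s).
Proof. intros Hs; unfold curvature; now rewrite Ds_tangent_unit_speed. Qed.

Lemma vnorm_c2_neq_0 s : D s -> vnorm (c2 s) <> 0.
Proof.
  intros Hs; rewrite <- (curvature_unit_speed s Hs); now apply curved.
Qed.

Lemma normal_unit_speed s : D s -> normal c s = scal (/ vnorm (c2 s)) (c2 s).
Proof.
  intros Hs; unfold normal.
  now rewrite Ds_tangent_unit_speed, curvature_unit_speed.
Qed.

Lemma tangent_derive_normal s :
  D s -> is_derive (tangent c) s (scal (curvature c s) (normal c s)).
Proof.
  intros Hs; apply is_derive_eq with (c2 s); [now apply tangent_derive|].
  rewrite (normal_unit_speed s Hs), (curvature_unit_speed s Hs).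
  pose proof (vnorm_c2_neq_0 s Hs).
  apply R3_ext; vcoord; field; assumption.
Qed.

(** The coefficient [k] is the derivative of [1 / |c2|]. It can stay unnamed because [c2] is
    parallel to the normal, so that its term does not affect the torsion. *)
Lemma normal_derive s : D s ->
  exists k : R, is_derive (normal c) s
    (plus (scal k (c2 s)) (scal (/ vnorm (c2 s)) (c3 s))).
Proof.
  intros Hs; pose proof (vnorm_c2_neq_0 s Hs) as Hn.
  eexists.
  apply is_derive_ext_loc with (fun t => scal (/ vnorm (c2 t)) (c2 t)).
  - apply filter_imp with D; [|now apply D_locally].
    intros t Ht; symmetry; now apply normal_unit_speed.
  - apply (is_derive_vscal (fun t => / vnorm (c2 t))).
    + apply is_derive_inv; [|exact Hn].
      apply is_derive_vnorm; [now apply c2_derive | exact Hn].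
    + now apply c2_derive.
Qed.

Lemma tangent_unit s : D s -> dot (tangent c s) (tangent c s) = 1.
Proof.
  intros Hs; rewrite (tangent_unit_speed s Hs).
  rewrite <- (is_derive_vDerive _ _ _ (c_derive s Hs)).
  now apply dot_self_1, unit_speed.
Qed.

Lemma normal_unit s : D s -> dot (normal c s) (normal c s) = 1.
Proof.
  intros Hs; pose proof (vnorm_c2_neq_0 s Hs) as Hn.
  rewrite (normal_unit_speed s Hs), dot_scal_l, dot_scal_r, <- vnorm_sqr.
  now field.
Qed.

Lemma tangent_normal s : D s -> dot (tangent c s) (normal c s) = 0.
Proof.
  intros Hs; pose proof (tangent_derive s Hs) as HT.
  (* Differentiating [T . T = 1] gives [2 T . c2 = 0], and [N] is parallel to [c2]. *)
  assert (H := is_derive_dot_constant _ _ s 1 _ _ HT HT).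
  rewrite (dot_comm (c2 s)) in H.
  rewrite (normal_unit_speed s Hs), dot_scal_r.
  replace (dot (tangent c s) (c2 s)) with 0; [ring|].
  enough (dot (tangent c s) (c2 s) + dot (tangent c s) (c2 s) = 0) by lra.
  apply H, filter_imp with D; [apply tangent_unit | now apply D_locally].
Qed.

(** [N'] is expanded in the orthonormal frame: [N . N = 1] kills its normal component, [T . N = 0]
    turns the tangential one into [- kappa], and the binormal one is the torsion by definition. [B']
    then follows from [B = T x N]. *)
Lemma frenet_serret : frenet_frame D (curvature c) (torsion c)
  (tangent c) (normal c) (binormal c).
Proof.
  intros s Hs.
  pose proof (tangent_unit s Hs) as HT; pose proof (normal_unit s Hs) as HN.
  pose proof (tangent_normal s Hs) as HTN.
  pose proof (tangent_derive_normal s Hs) as dT.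
  destruct (normal_derive s Hs) as [k dN].
  assert (dN' : is_derive (normal c) s
    (plus (scal (- curvature c s) (tangent c s))
       (scal (torsion c s) (binormal c s)))).
  { eapply is_derive_eq; [exact dN|].
    set (n1 := plus (scal k (c2 s)) (scal (/ vnorm (c2 s)) (c3 s))) in *.
    rewrite (orthonormal_decomposition _ _ n1 HT HN HTN).
    fold (binormal c s).
    assert (H1 : dot n1 (normal c s) = 0).
    { enough (dot n1 (normal c s) + dot (normal c s) n1 = 0)
        by (rewrite (dot_comm (normal c s)) in *; lra).
      apply (is_derive_dot_constant (normal c) (normal c) s 1); try assumption.
      apply filter_imp with D; [apply normal_unit | now apply D_locally]. }
    assert (H2 : dot n1 (tangent c s) = - curvature c s).
    { assert (H := is_derive_dot_constant _ _ s 0 _ _ dT dN).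
      fold n1 in H; rewrite dot_scal_l, HN, (dot_comm (tangent c s)) in H.
      enough (curvature c s * 1 + dot n1 (tangent c s) = 0) by lra.
      apply H, filter_imp with D; [apply tangent_normal | now apply D_locally]. }
    rewrite H1, H2; unfold torsion.
    rewrite (Ds_unit_speed _ s _ Hs dN); fold n1; vext. }
  repeat (split; [assumption || reflexivity|]).
  eapply is_derive_eq.
  (* In [T' x N + T x N'] the products [N x N] and [T x T] vanish, and
     [T x B = T x (T x N) = - N]. *)
  - exact (is_derive_cross _ _ _ _ _ dT dN').
  - unfold binormal.
    rewrite cross_plus_r, !cross_scal_r, cross_scal_l, cross_cross_r,
      !cross_diag, HT, HTN.
    vext.
Qed.

(** This form trades the derivative of the normal for [c3], whose continuity then gives that of the
    torsion. *)
Lemma torsion_unit_speed s :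
  D s -> torsion c s = / vnorm (c2 s) * dot (c3 s) (binormal c s).
Proof.
  intros Hs; destruct (normal_derive s Hs) as [k dN].
  unfold torsion; rewrite (Ds_unit_speed _ s _ Hs dN).
  rewrite dot_plus_l, !dot_scal_l.
  replace (dot (c2 s) (binormal c s)) with 0; [ring|].
  pose proof (vnorm_c2_neq_0 s Hs) as Hn.
  replace (c2 s) with (scal (vnorm (c2 s)) (normal c s)).
  - unfold binormal; rewrite dot_scal_l, dot_cross_r; ring.
  - rewrite (normal_unit_speed s Hs); apply R3_ext; vcoord; now field.
Qed.

Lemma continuous_on_ext (f g : R -> R) :
  (forall s, D s -> f s = g s) -> (forall s, D s -> continuous f s) ->
  forall s, D s -> continuous g s.
Proof.
  intros Hfg Hf s Hs; apply continuous_ext_loc with f; [|now apply Hf].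
  apply filter_imp with D; [exact Hfg | now apply D_locally].
Qed.

Lemma continuous_vnorm_c2 s : D s -> continuous (fun t => vnorm (c2 t)) s.
Proof.
  intros Hs; eapply (is_derive_continuous).
  apply is_derive_vnorm; [now apply c2_derive | now apply vnorm_c2_neq_0].
Qed.

Lemma continuous_curvature s : D s -> continuous (curvature c) s.
Proof.
  apply (continuous_on_ext (fun t => vnorm (c2 t))).
  - intros t Ht; symmetry; now apply curvature_unit_speed.
  - exact continuous_vnorm_c2.
Qed.

Lemma continuous_torsion s : D s -> continuous (torsion c) s.
Proof.
  apply (continuous_on_ext
    (fun t => / vnorm (c2 t) * dot (c3 t) (binormal c t))).
  - intros t Ht; symmetry; now apply torsion_unit_speed.
  - intros t Ht; apply (continuous_mult (K := R_AbsRing)).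
    + apply continuous_comp with (g := Rinv); [now apply continuous_vnorm_c2|].
      now apply continuous_Rinv, vnorm_c2_neq_0.
    + apply continuous_dot; [now apply c3_continuous|].
      eapply is_derive_vcontinuous.
      exact (frame_binormal_derive _ _ _ _ _ _ frenet_serret t Ht).
Qed.

Lemma indicatrix_speed s : D s -> vnorm (vDerive (tangent c) s) = curvature c s.
Proof.
  intros Hs; rewrite (is_derive_vDerive _ _ _ (tangent_derive s Hs)).
  symmetry; now apply curvature_unit_speed.
Qed.

Lemma curvature_pos s : D s -> 0 < curvature c s.
Proof.
  intros Hs; pose proof (curved s Hs).
  assert (0 <= curvature c s) by apply sqrt_pos; lra.
Qed.

End UnitSpeed.

(** * Differentiation of integrals with respect to the upper bound *)

(** The integral must exist for all upper bounds near [x]: openness keeps these in [D], and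
    convexity keeps the segment from [x0] in [D], where [f] is continuous. *)
Lemma is_derive_RInt_on (D : R -> Prop) (f : R -> R) (x0 x : R) :
  (forall s, D s -> locally s D) ->
  (forall x y z, D x -> D z -> x <= y <= z -> D y) ->
  (forall s, D s -> continuous f s) -> D x0 -> D x ->
  is_derive (fun y => RInt f x0 y) x (f x).
Proof.
  intros Dloc Dconv Hf Hx0 Hx.
  apply (is_derive_RInt (V := R_NormedModule) f _ x0 x); [|now apply Hf].
  apply filter_imp with D; [|now apply Dloc].
  intros y Hy; apply (RInt_correct (V := R_CompleteNormedModule)).
  apply (ex_RInt_continuous (V := R_CompleteNormedModule)).
  intros z Hz; apply Hf; unfold Rmin, Rmax in Hz.
  destruct (Rle_dec x0 y); eapply Dconv; [| |exact Hz| | |exact Hz]; assumption.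
Qed.

Lemma is_derive_vRInt_on (D : R -> Prop) (X : R -> R3) (x0 x : R) :
  (forall s, D s -> locally s D) ->
  (forall x y z, D x -> D z -> x <= y <= z -> D y) ->
  (forall s, D s -> continuous X s) -> D x0 -> D x ->
  is_derive (fun y => vRInt X x0 y) x (X x).
Proof.
  intros Dloc Dconv HX Hx0 Hx.
  apply is_derive_coord; split; [|split].
  - apply (is_derive_RInt_on D (fun u => vx (X u))); try assumption.
    intros s Hs.
    exact (proj1 (proj1 (continuous_coord X s) (HX s Hs))).
  - apply (is_derive_RInt_on D (fun u => vy (X u))); try assumption.
    intros s Hs.
    exact (proj1 (proj2 (proj1 (continuous_coord X s) (HX s Hs)))).
  - apply (is_derive_RInt_on D (fun u => vz (X u))); try assumption.
    intros s Hs.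
    exact (proj2 (proj2 (proj1 (continuous_coord X s) (HX s Hs)))).
Qed.

(** * The inverse of a function with positive derivative on an open interval *)

Section Inverse.

Context (D : R -> Prop) (g k S : R -> R).
Context (D_locally : forall s, D s -> locally s D)
  (D_convex : forall x y z, D x -> D z -> x <= y <= z -> D y)
  (g_derive : forall s, D s -> is_derive g s (k s))
  (k_pos : forall s, D s -> 0 < k s)
  (S_g : forall s, D s -> S (g s) = s).

Lemma derive_pos_increasing x y : D x -> D y -> x < y -> g x < g y.
Proof.
  intros Hx Hy Hxy.
  destruct (MVT_gen g x y k) as [z [Hz Hg]].
  - intros z; rewrite Rmin_left, Rmax_right by lra; intros Hz.
    apply g_derive, (D_convex x z y); try assumption; lra.
  - intros z; rewrite Rmin_left, Rmax_right by lra; intros Hz.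
    apply continuity_pt_filterlim, (is_derive_continuous _ _ (k z)).
    apply g_derive, (D_convex x z y); assumption.
  - rewrite Rmin_left, Rmax_right in Hz by lra.
    pose proof (k_pos z (D_convex x z y Hx Hy Hz)); nra.
Qed.

Lemma increasing_IVT x z y : D x -> D z -> x < z -> g x <= y <= g z ->
  exists w, x <= w <= z /\ g w = y.
Proof.
  (* The intermediate value theorem used below needs strict signs at the ends, so values attained at
     [x] or [z] are treated first. *)
  intros Hx Hz Hxz [[Hxy | Hxy] Hyz]; [|now exists x; split; [lra|]].
  destruct Hyz as [Hyz | Hyz]; [|now exists z; split; [lra|]].
  destruct (IVT_interv (fun w => g w - y) x z) as [w [Hw Hgw]]; try lra.
  - intros w Hw; apply continuity_pt_filterlim.
    apply (continuous_minus (V := R_NormedModule)); [|apply continuous_const].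
    apply (is_derive_continuous _ _ (k w)).
    now apply g_derive, (D_convex x w z).
  - exists w; split; [exact Hw | lra].
Qed.

Lemma neighbours s (eps : posreal) : D s ->
  exists x z, D x /\ D z /\ s - eps < x < s /\ s < z < s + eps.
Proof.
  intros Hs; destruct (D_locally s Hs) as [e He].
  (* Halving the minimum keeps [s - d] and [s + d] strictly within both radii. *)
  set (d := Rmin eps e / 2).
  assert (Hd : 0 < d /\ d < eps /\ d < e).
  { unfold d; pose proof (cond_pos eps); pose proof (cond_pos e).
    unfold Rmin; destruct (Rle_dec eps e); lra. }
  exists (s - d), (s + d); repeat split; try lra;
    apply He; apply Rabs_lt_between'; lra.
Qed.

Lemma image_convex x y z : image D g x -> image D g z -> x <= y <= z -> image D g y.
Proof.
  intros [u [Hu ->]] [v [Hv ->]] Hy.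
  destruct (Rtotal_order u v) as [H | [<- | H]].
  - destruct (increasing_IVT u v y Hu Hv H Hy) as [w [Hw <-]].
    exists w; split; [now apply (D_convex u w v) | reflexivity].
  - exists u; split; [exact Hu | lra].
  - pose proof (derive_pos_increasing v u Hv Hu H); lra.
Qed.

(** For neighbours [x < s < z] in [D], strict monotonicity puts [g s] inside the open interval from
    [g x] to [g z], which the image contains by convexity. *)
Lemma image_locally y : image D g y -> locally y (image D g).
Proof.
  intros [s [Hs ->]].
  destruct (neighbours s (mkposreal 1 Rlt_0_1) Hs) as [x [z [Hx [Hz [H1 H2]]]]].
  apply (locally_interval _ (g s) (g x) (g z)); simpl.
  - apply derive_pos_increasing; tauto.
  - apply derive_pos_increasing; tauto.
  - intros y H3 H4; apply (image_convex (g x) y (g z));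
      [now exists x | now exists z | lra].
Qed.

(** Every value between [g x] and [g z] is some [g w] with [w] between [x] and [z], and these
    neighbours of [s] can be taken within [eps]. *)
Lemma inverse_continuous s : D s -> continuous S (g s).
Proof.
  intros Hs; apply filterlim_locally; intros eps.
  destruct (neighbours s eps Hs) as [x [z [Hx [Hz [H1 H2]]]]].
  apply (locally_interval _ (g s) (g x) (g z)); simpl.
  - apply derive_pos_increasing; tauto.
  - apply derive_pos_increasing; tauto.
  - intros y H3 H4.
    destruct (increasing_IVT x z y Hx Hz) as [w [Hw <-]]; try lra.
    rewrite (S_g s Hs), (S_g w (D_convex x w z Hx Hz Hw)).
    apply Rabs_lt_between'; lra.
Qed.

Lemma inverse_derive s : D s -> is_derive S (g s) (/ k s).
Proof.
  intros Hs.
  destruct (neighbours s (mkposreal 1 Rlt_0_1) Hs) as [x [z [Hx [Hz [H1 H2]]]]].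
  assert (Prf : forall w, S (g x) <= w <= S (g z) -> derivable_pt g w).
  { intros w; rewrite !S_g by assumption; intros Hw.
    apply ex_derive_Reals_0; exists (k w).
    now apply g_derive, (D_convex x w z). }
  assert (Hincr : S (g x) <= S (g s) <= S (g z)) by (rewrite !S_g by assumption; lra).
  (* The inverse function theorem expresses the derivative through [derive_pt], which carries a
     differentiability proof; it is identified with [k s] here. *)
  assert (Hk : derive_pt g (S (g s)) (Prf (S (g s)) Hincr) = k s).
  { rewrite Derive_Reals, S_g by assumption.
    now apply is_derive_unique, g_derive. }
  pose proof (k_pos s Hs).
  apply is_derive_Reals; replace (/ k s) with (1 / k s) by (field; lra).
  rewrite <- Hk.
  pose proof (derive_pos_increasing x s Hx Hs ltac:(lra)).
  pose proof (derive_pos_increasing s z Hs Hz ltac:(lra)).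
  apply (derivable_pt_lim_recip_interv g S (g x) (g z)); try lra.
  - now apply continuity_pt_filterlim, inverse_continuous.
  - intros y Hy; unfold comp, id.
    destruct (increasing_IVT x z y Hx Hz) as [w [Hw <-]]; try lra.
    now rewrite (S_g w (D_convex x w z Hx Hz Hw)).
Qed.

End Inverse.

(** By the chain rule each derivative is divided by [k], so the coefficients [k] and [w] become [1]
    and [w / k]. *)
Lemma frenet_frame_reparametrize (D : R -> Prop) (g k w S : R -> R)
    (T N B : R -> R3) :
  (forall s, D s -> S (g s) = s) ->
  (forall s, D s -> 0 < k s) ->
  (forall s, D s -> is_derive S (g s) (/ k s)) ->
  frenet_frame D k w T N B ->
  frenet_frame (image D g) (fun _ => 1) (fun y => w (S y) / k (S y))
    (fun y => T (S y)) (fun y => N (S y)) (fun y => B (S y)).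
Proof.
  intros HS Hk dS HF y [s [Hs ->]]; cbv beta; rewrite (HS s Hs).
  assert (chain : forall (X : R -> R3) l, is_derive X s l ->
    is_derive (fun y => X (S y)) (g s) (scal (/ k s) l)).
  { intros X l HX; apply (is_derive_comp X S); [|now apply dS].
    now rewrite (HS s Hs). }
  pose proof (Hk s Hs).
  destruct (HF s Hs) as [HT [HN [HTN [HB [dT [dN dB]]]]]].
  repeat (split; [assumption|]); split; [|split].
  - eapply is_derive_eq; [exact (chain _ _ dT)|].
    apply R3_ext; vcoord; field; lra.
  - eapply is_derive_eq; [exact (chain _ _ dN)|].
    apply R3_ext; vcoord; field; lra.
  - eapply is_derive_eq; [exact (chain _ _ dB)|].
    apply R3_ext; vcoord; field; lra.
Qed.

(** * Derivatives of thrice differentiable curves, and open intervals with possibly infinite ends *)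

Lemma real_C3_derive (D : R -> Prop) (f : R -> R) (n : nat) (t : R) :
  real_C3_on D f -> D t -> (n < 3)%nat ->
  is_derive (Derive_n f n) t (Derive_n f (Datatypes.S n) t).
Proof.
  intros Hf Ht Hn; apply Derive_correct.
  exact (proj1 (Hf t Ht) (Datatypes.S n) Hn).
Qed.

Lemma C3_derive (D : R -> Prop) (c : R -> R3) : C3_on D c ->
  exists c1 c2 c3 : R -> R3, forall t, D t ->
    is_derive c t (c1 t) /\ is_derive c1 t (c2 t) /\ is_derive c2 t (c3 t) /\
    continuous c3 t.
Proof.
  intros [Hx [Hy Hz]].
  set (d := fun n t => (Derive_n (fun t => vx (c t)) n t,
    Derive_n (fun t => vy (c t)) n t, Derive_n (fun t => vz (c t)) n t) : R3).
  assert (Hd : forall n t, (n < 3)%nat -> D t ->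
    is_derive (d n) t (d (Datatypes.S n) t)).
  { intros n t Hn Ht; apply is_derive_coord; split; [|split];
      eapply (real_C3_derive D); eassumption. }
  exists (d 1%nat), (d 2%nat), (d 3%nat); intros t Ht; split; [|split; [|split]].
  - apply is_derive_ext with (d 0%nat); [now intros s; apply R3_ext|].
    apply Hd; [repeat constructor | exact Ht].
  - apply Hd; [repeat constructor | exact Ht].
  - apply Hd; [repeat constructor | exact Ht].
  - apply continuous_coord; split; [|split];
      [apply Hx | apply Hy | apply Hz]; exact Ht.
Qed.

Lemma Rbar_interval_locally (lo hi : Rbar) (t : R) :
  Rbar_interval lo hi t -> locally t (Rbar_interval lo hi).
Proof.
  intros [Hlo Hhi].
  apply (locally_interval _ t lo hi Hlo Hhi); now split.
Qed.

Lemma Rbar_interval_convex (lo hi : Rbar) (x y z : R) :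
  Rbar_interval lo hi x -> Rbar_interval lo hi z -> x <= y <= z ->
  Rbar_interval lo hi y.
Proof.
  intros [Hx _] [_ Hz] [Hxy Hyz]; split.
  - now apply Rbar_lt_le_trans with x.
  - now apply Rbar_le_lt_trans with z.
Qed.

(** * The curve built on the tangent indicatrix of [alpha] *)

Theorem theorem2 (lo hi : Rbar) (alpha : R -> R3) (S : R -> R)
    (a theta sigma0 : R) (c : R3) :
  let I := Rbar_interval lo hi in
  let J := image I (indicatrix_arclength alpha) in
  let gamma := gamma_T alpha S a theta sigma0 c in
  I 0 ->
  C3_on I alpha ->
  (forall s, I s -> vnorm (vDerive alpha s) = 1) ->
  (forall s, I s -> curvature alpha s <> 0) ->
  (forall s, I s -> S (indicatrix_arclength alpha s) = s) ->
  sin theta <> 0 ->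
  J sigma0 ->
  (forall sigma, J sigma -> vDerive gamma sigma <> zero) ->
  (forall sigma, J sigma -> curvature gamma sigma <> 0) ->
  bertrand_curve J gamma /\
  (cos theta <> 0 -> bertrand_relation J gamma).
Proof.
  intros I J gamma HI0 HC3 Hunit Hcurv HS Hsin Hsigma0 Hreg Hcurved.
  destruct (C3_derive I alpha HC3) as [c1 [c2 [c3 Hc]]].
  assert (d0 : forall s, I s -> is_derive alpha s (c1 s))
    by (intros s Hs; now destruct (Hc s Hs) as [? [? [? ?]]]).
  assert (d1 : forall s, I s -> is_derive c1 s (c2 s))
    by (intros s Hs; now destruct (Hc s Hs) as [? [? [? ?]]]).
  assert (d2 : forall s, I s -> is_derive c2 s (c3 s))
    by (intros s Hs; now destruct (Hc s Hs) as [? [? [? ?]]]).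
  assert (cont3 : forall s, I s -> continuous c3 s)
    by (intros s Hs; now destruct (Hc s Hs) as [? [? [? ?]]]).
  pose proof (Rbar_interval_locally lo hi : forall s, I s -> locally s I) as Iloc.
  pose proof (Rbar_interval_convex lo hi
    : forall x y z, I x -> I z -> x <= y <= z -> I y) as Iconv.
  pose proof (frenet_serret I alpha c1 c2 c3 Iloc d0 d1 d2 Hunit Hcurv) as HF.
  pose proof (continuous_curvature I alpha c1 c2 c3 Iloc d0 d1 d2 Hunit Hcurv)
    as Hkc.
  pose proof (continuous_torsion I alpha c1 c2 c3 Iloc d0 d1 d2 cont3 Hunit Hcurv)
    as Htc.
  pose proof (curvature_pos I alpha Hcurv) as Hkpos.
  pose proof (indicatrix_speed I alpha c1 c2 Iloc d0 d1 Hunit) as Hspeed.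
  set (g := indicatrix_arclength alpha) in *.
  (* The integrand of the indicatrix arc length is [|T'| = kappa], continuous on [I], so the
     derivative of [g] is the positive function [kappa] and [g] can be inverted. *)
  assert (dg : forall s, I s -> is_derive g s (curvature alpha s)).
  { intros s Hs; rewrite <- (Hspeed s Hs).
    apply (is_derive_RInt_on I (fun u => vnorm (vDerive (tangent alpha) u)));
      try assumption.
    apply (continuous_on_ext I Iloc (curvature alpha)); [|exact Hkc].
    intros t Ht; symmetry; now apply Hspeed. }
  pose proof (inverse_derive I g (curvature alpha) S Iloc Iconv dg Hkpos HS) as dS.
  pose proof (image_locally I g (curvature alpha) Iloc Iconv dg Hkpos
    : forall y, J y -> locally y J) as Jloc.
  pose proof (image_convex I g (curvature alpha) Iconv dg Hkpos
    : forall x y z, J x -> J z -> x <= y <= z -> J y) as Jconv.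
  pose proof (frenet_frame_reparametrize I g _ _ S _ _ _ HS Hkpos dS HF) as HJ.
  fold J in HJ.
  set (T := fun y => tangent alpha (S y)) in HJ.
  set (N := fun y => normal alpha (S y)) in HJ.
  set (B := fun y => binormal alpha (S y)) in HJ.
  set (f := fun y => torsion alpha (S y) / curvature alpha (S y)) in HJ.
  set (m := cos theta / sin theta).
  assert (Hf : forall y, J y -> continuous f y).
  { intros y [s [Hs ->]].
    pose proof (is_derive_continuous _ _ _ (dS s Hs)) as HSc.
    apply (continuous_mult (K := R_AbsRing)).
    - apply (continuous_comp S (torsion alpha)); [exact HSc|].
      rewrite (HS s Hs); now apply Htc.
    - apply (continuous_comp (fun y => curvature alpha (S y)) Rinv).
      + apply (continuous_comp S (curvature alpha)); [exact HSc|].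
        rewrite (HS s Hs); now apply Hkc.
      + apply continuous_Rinv; rewrite (HS s Hs); now apply Hcurv. }
  (* Both integrands are continuous on [J], being differentiable frame fields, so differentiating
     the integrals returns [T] and [B]. *)
  assert (dgamma : forall y, J y ->
    is_derive gamma y (scal a (plus (T y) (scal m (B y))))).
  { intros y Hy.
    assert (dT : is_derive (fun y => vRInt T sigma0 y) y (T y)).
    { apply (is_derive_vRInt_on J); try assumption.
      intros z Hz; eapply is_derive_vcontinuous.
      exact (frame_tangent_derive _ _ _ _ _ _ HJ z Hz). }
    assert (dB : is_derive (fun y => vRInt B sigma0 y) y (B y)).
    { apply (is_derive_vRInt_on J); try assumption.
      intros z Hz; eapply is_derive_vcontinuous.
      exact (frame_binormal_derive _ _ _ _ _ _ HJ z Hz). }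
    eapply is_derive_eq.
    - exact (is_derive_plus _ _ _ _ _
        (is_derive_plus _ _ _ _ _ (is_derive_vscal_const a _ _ _ dT)
           (is_derive_vscal_const (a * m) _ _ _ dB))
        (is_derive_const c y)).
    - vext. }
  split.
  (* The base point [sigma0] of the integrals also serves as the distinguished point of [J]. *)
  - exact (bertrand_gamma J T N B gamma f a m sigma0 Jloc Jconv Hsigma0 HJ Hf
      dgamma Hreg Hcurved).
  - intros Hcos.
    apply (bertrand_relation_gamma J T N B gamma f a m sigma0); try assumption.
    (* The remaining condition is [m = cot theta <> 0], which holds because [cos theta] is
       non-zero. *)
    apply Rmult_integral_contrapositive_currified;
      [exact Hcos | now apply Rinv_neq_0_compat].
Qed.
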